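(* Let $X$ and $Y$ be a pair of pseudotopological CW complexes. Then their categorical product $X\times Y$ in $\mathbf{PsTop}$ is a pseudotopological CW complex.
   Context: A pseudotopological space is a pair $(X,q)$ where $X$ is a set and $q$ is a set of pairs $(\mathcal F,x)$, with $\mathcal F$ a filter on $X$ and $x\in X$ (read ''$\mathcal F$ converges to $x$''), such that: (i) the principal ultrafilter $[x]$ converges to $x$ for every $x$; (ii) if $\mathcal F$ converges to $x$ and $\mathcal G\supset\mathcal F$ then $\mathcal G$ converges to $x$; (iii) if $\mathcal F,\mathcal G$ converge to $x$ so does $\mathcal F\cap\mathcal G$; (iv) if every ultrafilter $\mathcal U\supset\mathcal F$ converges to $x$ then $\mathcal F$ converges to $x$. A map $f$ is continuous if $f(\mathcal F)$ converges to $f(x)$ whenever $\mathcal F$ converges to $x$. This gives the category $\mathbf{PsTop}$, which has all small limits and colimits; topological spaces form a full subcategory (a filter converges to $x$ iff it contains the neighborhood filter of $x$). A pseudotopological CW complex is a pseudotopological space $X$ that is the colimit in $\mathbf{PsTop}$ of a sequence $\varnothing=X_{-1}\to X_0\to X_1\to\cdots$ in which, for each $n\ge0$, $X_n$ is a pushout in $\mathbf{PsTop}$ of $X_{n-1}\leftarrow\bigsqcup_{i\in I_n}S^{n-1}\to\bigsqcup_{i\in I_n}D^n$ (with $S^{-1}=\varnothing$, $D^0$ a point). *)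

(* Defs.v *)
From HB Require Import structures.
From mathcomp Require Import all_boot all_order all_algebra.
From mathcomp Require Import all_classical all_reals all_analysis.

Set Implicit Arguments.
Unset Strict Implicit.
Unset Printing Implicit Defensive.

Import Order.TTheory GRing.Theory Num.Theory.
Import numFieldNormedType.Exports.

Local Open Scope classical_set_scope.
Local Open Scope ring_scope.

(* [pconv F x] reads "F converges to x". Filters are proper; the improper filter
   would converge to every point by [pconv_ultra] anyway. *)
Record psTop : Type := PsTop {
  pcarrier :> Type;
  pconv : set_system pcarrier -> pcarrier -> Prop;
  pconv_proper : forall F x, pconv F x -> ProperFilter F;
  pconv_principal : forall x, pconv (principal_filter x) x;
  pconv_finer : forall F G x,
    ProperFilter G -> F `<=` G -> pconv F x -> pconv G x;
  pconvI : forall F G x, pconv F x -> pconv G x -> pconv (F `&` G) x;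
  pconv_ultra : forall F x, ProperFilter F ->
    (forall U, UltraFilter U -> F `<=` U -> pconv U x) -> pconv F x
}.

Definition pcontinuous (X Y : psTop) (f : X -> Y) : Prop :=
  forall F x, pconv F x -> pconv (f @ F) (f x).

Lemma properfilterI T (F G : set_system T) :
  ProperFilter F -> ProperFilter G -> ProperFilter (F `&` G).
Proof.
move=> FF GG; split; first by case=> F0 _; exact: (filter_not_empty F).
split; first by split; exact: filterT.
- by move=> A B [FA GA] [FB GB]; split; exact: filterI.
- by move=> A B AB [FA GA]; split; exact: filterS AB _.
Qed.

Lemma filter_ultraP T (F : set_system T) (A : set T) : ProperFilter F ->
  (forall U, UltraFilter U -> F `<=` U -> U A) -> F A.
Proof.
move=> FF FUA; apply: contrapT => nFA.
have WF : ProperFilter (within (~` A) F).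
  split; last exact: within_filter.
  rewrite /within /= => FAA; apply: nFA; apply: filterS FAA => x /= xA.
  by apply: contrapT => /xA.
have [U [UU WU]] := ultraFilterLemma WF.
apply: (filter_not_empty U); rewrite -(setICr A); apply: filterI.
  apply: FUA => B FB; apply: WU; rewrite /within /=.
  by apply: filterS FB => x Bx _.
by apply: WU; exact: withinT.
Qed.

Lemma ultra_fmap T U (f : T -> U) (F : set_system T) :
  UltraFilter F -> UltraFilter (f @ F).
Proof.
move=> FU; split=> [|G GG fFG].
  exact: fmap_proper_filter.
rewrite eqEsubset; split=> // A GA.
have [//|FA] := in_ultra_setVsetC (f @^-1` A) FU.
exfalso; apply: (filter_not_empty G); rewrite -(setICr A); apply: filterI => //.
exact: fFG.
Qed.

Lemma ultra_fmap_lift T U (f : T -> U) (F : set_system T) (V : set_system U) :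
  ProperFilter F -> UltraFilter V -> f @ F `<=` V ->
  exists W, [/\ UltraFilter W, F `<=` W & f @ W = V].
Proof.
move=> FF VU FV.
have GP : ProperFilter
    (filter_from (fun BC : set T * set U => F BC.1 /\ V BC.2)
       (fun BC => BC.1 `&` f @^-1` BC.2)).
  apply: filter_from_proper; first apply: filter_from_filter.
  - by exists (setT, setT); split; exact: filterT.
  - move=> [B C] [B' C'] /= [FB VC] [FB' VC'].
    exists (B `&` B', C `&` C'); first by split; exact: filterI.
    by move=> x /= [[? ?] [? ?]].
  - move=> [B C] /= [FB VC].
    have /filter_ex[y [[x Bx fxy] Cy]] : V (f @` B `&` C).
      apply: filterI => //; apply: FV => /=.
      by apply: filterS FB => x Bx; exists x.
    by exists x; split=> //; rewrite /preimage /= fxy.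
have [W [WU GW]] := ultraFilterLemma GP.
exists W; split=> // [B FB|].
  apply: GW; exists (B, setT) => /=; first by split=> //; exact: filterT.
  by move=> x [].
apply: (@max_filter _ _ VU (f @ W)).
move=> C VC; apply: GW; exists (setT, C) => /=.
  by split=> //; exact: filterT.
by move=> x [].
Qed.

Lemma fmap_image_inj T U (f : T -> U) (F : set_system U) :
  injective f -> ProperFilter F -> F (range f) ->
  ProperFilter [set B | F (f @` B)] /\ F = fmap f [set B | F (f @` B)].
Proof.
move=> finj FF FT; split.
  split; first by rewrite /= image_set0; exact: filter_not_empty.
  split=> [|A B FA FB|A B AB]; first exact: FT.
    apply: (@filterS _ F) (@filterI _ F _ _ _ FA FB) => _ [[x Ax <-] [y By] /finj yx].
    by exists x => //; split=> //; rewrite -yx.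
  by apply: (@filterS _ F); exact: image_subset.
rewrite predeqE => A; split=> /= FA.
  apply: filterS (filterI FA FT) => y [Ay [x _ xE]].
  by exists x; rewrite // /preimage /= xE.
by apply: filterS FA => _ [x Ax <-].
Qed.

Section Topological.
Variable T : topologicalType.

Definition topconv (F : set_system T) (x : T) : Prop :=
  ProperFilter F /\ nbhs x `<=` F.

Fact topconv_proper F x : topconv F x -> ProperFilter F.
Proof. by case. Qed.

Fact topconv_principal x : topconv (principal_filter x) x.
Proof.
split; first exact: principal_filter_proper.
by move=> A /nbhs_singleton Ax; exact/principal_filterP.
Qed.

Fact topconv_finer F G x :
  ProperFilter G -> F `<=` G -> topconv F x -> topconv G x.
Proof. by move=> GG FG [_ xF]; split=> // A /xF; exact: FG. Qed.

Fact topconvI F G x : topconv F x -> topconv G x -> topconv (F `&` G) x.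
Proof.
move=> [FF xF] [GG xG]; split; first exact: properfilterI.
by move=> A xA; split; [exact: xF|exact: xG].
Qed.

Fact topconv_ultra F x : ProperFilter F ->
  (forall U, UltraFilter U -> F `<=` U -> topconv U x) -> topconv F x.
Proof.
move=> FF FU; split=> // A xA; apply: filter_ultraP => U UU FsU.
by have [_] := FU U UU FsU; exact.
Qed.

Definition ptop : psTop :=
  @PsTop T topconv topconv_proper topconv_principal topconv_finer topconvI
    topconv_ultra.

End Topological.

Section Product.
Variables X Y : psTop.

Definition prodconv (F : set_system (X * Y)) (p : X * Y) : Prop :=
  [/\ ProperFilter F, pconv (fst @ F) p.1 & pconv (snd @ F) p.2].

Fact prodconv_proper F p : prodconv F p -> ProperFilter F.
Proof. by case. Qed.

Fact prodconv_principal p : prodconv (principal_filter p) p.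
Proof.
split; first exact: principal_filter_proper.
- apply: pconv_finer (pconv_principal p.1) => [|A /principal_filterP Ap].
    by apply: fmap_proper_filter; exact: principal_filter_proper.
  exact/principal_filterP.
- apply: pconv_finer (pconv_principal p.2) => [|A /principal_filterP Ap].
    by apply: fmap_proper_filter; exact: principal_filter_proper.
  exact/principal_filterP.
Qed.

Fact prodconv_finer F G p :
  ProperFilter G -> F `<=` G -> prodconv F p -> prodconv G p.
Proof.
move=> GG FG [FF F1 F2]; split=> //.
- by apply: pconv_finer F1 => A; exact: FG.
- by apply: pconv_finer F2 => A; exact: FG.
Qed.

Fact prodconvI F G p : prodconv F p -> prodconv G p -> prodconv (F `&` G) p.
Proof.
move=> [FF F1 F2] [GG G1 G2]; split; first exact: properfilterI.
- exact: pconvI F1 G1.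
- exact: pconvI F2 G2.
Qed.

Fact prodconv_ultra F p : ProperFilter F ->
  (forall U, UltraFilter U -> F `<=` U -> prodconv U p) -> prodconv F p.
Proof.
move=> FF FU; split=> //.
- apply: pconv_ultra => V VU FV.
  by have [W [WU FW <-]] := ultra_fmap_lift FF VU FV; have [] := FU W WU FW.
- apply: pconv_ultra => V VU FV.
  by have [W [WU FW <-]] := ultra_fmap_lift FF VU FV; have [] := FU W WU FW.
Qed.

Definition pprod : psTop :=
  @PsTop (X * Y)%type prodconv prodconv_proper prodconv_principal
    prodconv_finer prodconvI prodconv_ultra.

Lemma pprod_universal :
  [/\ pcontinuous (fst : pprod -> X), pcontinuous (snd : pprod -> Y) &
   forall (Z : psTop) (f : Z -> X) (g : Z -> Y),
     pcontinuous f -> pcontinuous g ->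
     exists! h : Z -> pprod,
       [/\ pcontinuous h, forall z, (h z).1 = f z & forall z, (h z).2 = g z]].
Proof.
split=> [F p []|F p []|Z f g cf cg] //.
exists (fun z => (f z, g z)); split.
  split=> // F z Fz; have FF := pconv_proper Fz.
  split; [exact: fmap_proper_filter|exact: cf|exact: cg].
move=> h [_ hf hg]; apply/funext => z.
by rewrite -hf -hg -surjective_pairing.
Qed.

End Product.

Section Coproduct.
Variables (I : Type) (X : I -> psTop).

Definition sumconv (F : set_system {i : I & X i}) (p : {i : I & X i}) : Prop :=
  exists2 G, pconv G (projT2 p) & F = existT (fun i => X i) (projT1 p) @ G.

Fact sumconv_proper F p : sumconv F p -> ProperFilter F.
Proof.
by case=> G /pconv_proper GG ->; exact: fmap_proper_filter.
Qed.

Fact sumconv_principal p : sumconv (principal_filter p) p.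
Proof.
case: p => i x; exists (principal_filter x); first exact: pconv_principal.
rewrite predeqE => A; split=> [/principal_filterP Ax|].
  exact/principal_filterP.
by move=> Ax; apply/principal_filterP; move/principal_filterP : Ax.
Qed.

Lemma existT_inj i : injective (existT (fun i => X i) i).
Proof.
move=> x y e; have := projT2_eq e.
by rewrite (Prop_irrelevance (projT1_eq e) erefl).
Qed.

Fact sumconv_finer F G p :
  ProperFilter G -> F `<=` G -> sumconv F p -> sumconv G p.
Proof.
case: p => i x GG FG [F' F'x FE] /=; have F'F := pconv_proper F'x.
have GT : G (range (existT (fun i => X i) i)).
  apply: FG; rewrite FE /=.
  by apply: filterS filterT => y _; exists y.
have [G'P G'E] := fmap_image_inj (@existT_inj i) GG GT.
exists [set B | G (existT (fun i => X i) i @` B)] => //.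
apply: pconv_finer F'x => // A F'A; apply: FG; rewrite FE /=.
by apply: filterS F'A => y Ay; exists y.
Qed.

Fact sumconvI F G p : sumconv F p -> sumconv G p -> sumconv (F `&` G) p.
Proof.
move=> [F' F'x ->] [G' G'x ->]; exists (F' `&` G') => //; exact: pconvI.
Qed.

Fact sumconv_ultra F p : ProperFilter F ->
  (forall U, UltraFilter U -> F `<=` U -> sumconv U p) -> sumconv F p.
Proof.
case: p => i x FF FU.
have FT : F (range (existT (fun i => X i) i)).
  apply: filter_ultraP => U UU /(FU U UU)[G /pconv_proper GG ->] /=.
  by apply: filterS filterT => y _; exists y.
have [F'P F'E] := fmap_image_inj (@existT_inj i) FF FT.
exists [set B | F (existT (fun i => X i) i @` B)] => //=.
apply: pconv_ultra => V VU FV.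
have [|G Gx VG] := FU _ (ultra_fmap (existT (fun i => X i) i) VU).
  by rewrite F'E => A; exact: FV.
suff -> : V = G by [].
rewrite predeqE => A.
have AE : existT (fun i => X i) i @^-1` (existT (fun i => X i) i @` A) = A.
  rewrite eqEsubset; split=> [y [z Az /existT_inj <-//]|y Ay]; by exists y.
have /= := congr1 (@^~ (existT (fun i => X i) i @` A)) VG.
by rewrite /fmap /= /nbhs /= AE => ->.
Qed.

Definition psum : psTop :=
  @PsTop {i : I & X i} sumconv sumconv_proper sumconv_principal sumconv_finer
    sumconvI sumconv_ultra.

Lemma psum_universal :
  (forall i, pcontinuous (existT (fun i => X i) i : X i -> psum)) /\
  forall (Z : psTop) (f : forall i, X i -> Z),
    (forall i, pcontinuous (f i)) ->
    exists! h : psum -> Z,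
      pcontinuous h /\ forall i x, h (existT (fun i => X i) i x) = f i x.
Proof.
split=> [i F x Fx|Z f cf]; first by exists F.
exists (fun p => f (projT1 p) (projT2 p)); split.
  by split=> // F [i x] [G Gx ->]; exact: (cf i G x).
by move=> h [_ hf]; apply/funext => -[i x]; rewrite hf.
Qed.

End Coproduct.

Definition is_pushout (A B C P : psTop) (f : A -> B) (g : A -> C)
    (h : B -> P) (k : C -> P) : Prop :=
  [/\ [/\ pcontinuous f, pcontinuous g, pcontinuous h & pcontinuous k],
      forall a, h (f a) = k (g a) &
      forall (Z : psTop) (u : B -> Z) (v : C -> Z),
        pcontinuous u -> pcontinuous v -> (forall a, u (f a) = v (g a)) ->
        exists! w : P -> Z, [/\ pcontinuous w, forall b, w (h b) = u b &
                               forall c, w (k c) = v c]].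

Definition is_seq_colimit (S : nat -> psTop) (j : forall n, S n -> S n.+1)
    (X : psTop) (c : forall n, S n -> X) : Prop :=
  [/\ (forall n, pcontinuous (j n)) /\ (forall n, pcontinuous (c n)),
      forall n s, c n.+1 (j n s) = c n s &
      forall (Z : psTop) (u : forall n, S n -> Z),
        (forall n, pcontinuous (u n)) -> (forall n s, u n.+1 (j n s) = u n s) ->
        exists! w : X -> Z, pcontinuous w /\ forall n s, w (c n s) = u n s].

Section Cells.
Variables (R : realType) (n : nat).

(* The norm of the library on ['rV[R]_n] is the sup norm, so the Euclidean
   norm is spelled out. *)
Definition disk_set : set 'rV[R]_n := [set x | \sum_i x ord0 i ^+ 2 <= 1].

Definition sphere_set : set 'rV[R]_n := [set x | \sum_i x ord0 i ^+ 2 = 1].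

Lemma sphere_sub_disk : sphere_set `<=` disk_set.
Proof. by move=> x; rewrite /sphere_set /disk_set /= => ->. Qed.

Definition disk : psTop := ptop disk_set.

(* The unit sphere of R^n: [sphere R n] is S^(n-1), empty when n = 0. *)
Definition sphere : psTop := ptop sphere_set.

Definition sphere_incl (x : sphere) : disk :=
  exist _ (set_val x) (mem_set (sphere_sub_disk (set_mem (valP x)))).

Definition cells_incl (I : Type) (p : psum (fun _ : I => sphere)) :
    psum (fun _ : I => disk) :=
  existT _ (projT1 p) (sphere_incl (projT2 p)).

End Cells.

Arguments cells_incl {R} n I p.

(* [S n] is the (n-1)-skeleton: [S 0] is the empty space X_(-1), and [S n.+1]
   is obtained from [S n] by attaching n-cells. *)
Definition is_CW (R : realType) (X : psTop) : Prop :=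
  exists (S : nat -> psTop) (j : forall n, S n -> S n.+1)
         (c : forall n, S n -> X),
    [/\ S 0%N -> False,
        forall n, exists (I : Type)
            (phi : psum (fun _ : I => sphere R n) -> S n)
            (Phi : psum (fun _ : I => disk R n) -> S n.+1),
          is_pushout phi (cells_incl n I) (j n) Phi &
        is_seq_colimit j c].

(* Main.v *)
(* A pseudotopology is determined by the relation between ultrafilters and their
   limits, and a colimit in PsTop is the set-level colimit in which an ultrafilter
   converges iff it is the image of a convergent filter of one of the pieces.
   Unwinding the pushouts and the sequential colimit, a CW complex is a set
   partitioned into open cells in which an ultrafilter converges iff it comes from
   a convergent filter on a closed cell, spheres being attached continuously to
   the cells of lower dimension. This description is stable under products: an
   ultrafilter on X * Y whose two projections lift to filters on D^p and D^q lifts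
   to D^p * D^q, because ultrafilters can be amalgamated, and D^p * D^q is
   homeomorphic to D^(p+q) by a radial rescaling which matches the sphere
   S^(p+q-1) with the points having a coordinate on S^(p-1) or S^(q-1). *)
Require Import Defs.
From mathcomp Require Import all_boot all_order all_algebra.
From mathcomp Require Import all_classical all_reals all_analysis.
From mathcomp Require Import lra ring.

Set Implicit Arguments.
Unset Strict Implicit.
Unset Printing Implicit Defensive.

Import Order.TTheory GRing.Theory Num.Theory.
Import numFieldNormedType.Exports.

Local Open Scope classical_set_scope.
Local Open Scope ring_scope.

(** * Ultrafilters *)

Lemma fmap_principal T U (f : T -> U) (x : T) :
  f @ principal_filter x = principal_filter (f x).
Proof.
rewrite predeqE => A; split=> /= [/principal_filterP Ax|].
  exact/principal_filterP.
by move=> /principal_filterP Ax; apply/principal_filterP.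
Qed.

Lemma ultra_sub_principal T (U : set_system T) (x : T) :
  UltraFilter U -> principal_filter x `<=` U -> U = principal_filter x.
Proof.
move=> UU; apply: (@max_filter _ _ (principal_filter_ultra x)).
Qed.

(** If [A] is in [F] but not in [U], its complement is in [U]; for [B] in [G] the union of [A] and
    [B] is in [U], hence so is [B]. This gives closure under finite intersections for final
    structures. *)
Lemma ultra_subI T (F G U : set_system T) : UltraFilter U ->
  F `&` G `<=` U -> ProperFilter F -> ProperFilter G -> F `<=` U \/ G `<=` U.
Proof.
move=> UU FGU FF GG; have [FU|nFU] := pselect (F `<=` U); [by left|right=> B GB].
move/existsNP: nFU => [A /not_implyP[FA nUA]].
have [UA|UA] := in_ultra_setVsetC A UU; first by [].
have UAB : U (A `|` B).
  by apply: FGU; split; [apply: filterS FA|apply: filterS GB] => x; [left|right].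
by apply: filterS (filterI UA UAB) => x [nAx []].
Qed.

Lemma fmap_inj T U (f : T -> U) (F G : set_system T) :
  injective f -> f @ F = f @ G -> F = G.
Proof.
move=> finj FG; rewrite predeqE => A.
have fA : f @^-1` (f @` A) = A.
  by rewrite eqEsubset; split=> [x [y Ay /finj <-//]|x Ax]; exists x.
by have := congr1 (@^~ (f @` A)) FG; rewrite /= /fmap /nbhs /= fA => ->.
Qed.

Lemma ultra_fmap_inj T U (f : T -> U) (F : set_system T) : injective f ->
  ProperFilter F -> UltraFilter (f @ F) -> UltraFilter F.
Proof.
move=> finj FF fFU; split=> // G GG FG; apply: (fmap_inj finj).
by apply: max_filter => A; exact: FG.
Qed.

(* The ultrafilter functor preserves weak pullbacks. *)
Lemma ultra_amalgam A B X Y (f : A -> X) (g : B -> Y) (U : set_system (X * Y))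
    (V : set_system A) (W : set_system B) :
  UltraFilter U -> ProperFilter V -> ProperFilter W ->
  f @ V = fst @ U -> g @ W = snd @ U ->
  exists T, [/\ UltraFilter T, V `<=` fst @ T, W `<=` snd @ T &
                (fun p : A * B => (f p.1, g p.2)) @ T = U].
Proof.
move=> UU VV WW fVU gWU.
pose D (t : set A * set B * set (X * Y)) := [/\ V t.1.1, W t.1.2 & U t.2].
pose E (t : set A * set B * set (X * Y)) :=
  [set p : A * B | [/\ t.1.1 p.1, t.1.2 p.2 & t.2 (f p.1, g p.2)]].
have GP : ProperFilter (filter_from D E).
  apply: filter_from_proper; first apply: filter_from_filter.
  - by exists (setT, setT, setT); split; exact: filterT.
  - move=> [[P Q] C] [[P' Q'] C'] [VP WQ UC] [VP' WQ' UC'].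
    exists (P `&` P', Q `&` Q', C `&` C'); first by split; exact: filterI.
    by move=> x [[? ?] [? ?] [? ?]].
  - move=> [[P Q] C] [/= VP WQ UC].
    have UP : U (fst @^-1` (f @` P)).
      have : (f @ V) (f @` P) by apply: (@filterS _ V _ P) => // x Px; exists x.
      by rewrite fVU.
    have UQ : U (snd @^-1` (g @` Q)).
      have : (g @ W) (g @` Q) by apply: (@filterS _ W _ Q) => // x Qx; exists x.
      by rewrite gWU.
    have /filter_ex[[x y] [Cxy [[a Pa /= fa] [b Qb /= gb]]]] :
        U (C `&` (fst @^-1` (f @` P) `&` snd @^-1` (g @` Q))).
      by apply: filterI => //; exact: filterI.
    by exists (a, b); split=> //=; rewrite fa gb.
have [T [TU GT]] := ultraFilterLemma GP.
exists T; split=> // [P VP|Q WQ|].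
- by apply: GT; exists (P, setT, setT) => [|p []//]; split=> //; exact: filterT.
- by apply: GT; exists (setT, Q, setT) => [|p []//]; split=> //; exact: filterT.
- apply: max_filter => C UC; apply: GT.
  by exists (setT, setT, C) => [|p []//]; split=> //; exact: filterT.
Qed.

Lemma pcontinuous_ultra (X Y : psTop) (f : X -> Y) :
  (forall U x, UltraFilter U -> pconv U x -> pconv (f @ U) (f x)) ->
  pcontinuous f.
Proof.
move=> cf F x Fx; have FF := pconv_proper Fx.
apply: pconv_ultra => V VU FV.
have [W [WU FW <-]] := ultra_fmap_lift FF VU FV.
by apply: cf; apply: pconv_finer Fx.
Qed.

Lemma pcontinuous_comp (X Y Z : psTop) (f : X -> Y) (g : Y -> Z) :
  pcontinuous f -> pcontinuous g -> pcontinuous (g \o f).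
Proof. by move=> cf cg F x /cf/cg. Qed.

(** * Final pseudotopologies, pushouts and sequential colimits *)

Section Codiscrete.
Variable T : Type.

(** Every map into it is continuous, so a universal property tested on it yields the set-level
    colimit. *)
Definition codisc : psTop :=
  @PsTop T (fun F _ => ProperFilter F) (fun _ _ => id)
    (@principal_filter_proper T) (fun _ _ _ GG _ _ => GG)
    (fun _ _ _ => @properfilterI T _ _) (fun _ _ FF _ => FF).

Lemma pcontinuous_codisc (X : psTop) (f : X -> codisc) : pcontinuous f.
Proof. by move=> F x /pconv_proper FF; exact: fmap_proper_filter. Qed.

End Codiscrete.

Section Final.
Variables (K : Type) (A : K -> psTop) (T : Type) (f : forall k, A k -> T).

Definition flift (U : set_system T) (x : T) : Prop :=
  exists k (V : set_system (A k)) (a : A k),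
    [/\ pconv V a, U = @f k @ V & x = f a].

Hypothesis fsurj : forall x, exists k (a : A k), f a = x.

(** Images of convergent filters are imposed on ultrafilters only, and other filters are judged by
    their finer ultrafilters: this builds in the ultrafilter axiom. Surjectivity [fsurj] makes
    principal filters converge. *)
Definition finconv (F : set_system T) (x : T) : Prop :=
  ProperFilter F /\ forall U, UltraFilter U -> F `<=` U -> flift U x.

Fact finconv_proper F x : finconv F x -> ProperFilter F.
Proof. by case. Qed.

Fact finconv_principal x : finconv (principal_filter x) x.
Proof.
split; first exact: principal_filter_proper.
move=> U UU /(ultra_sub_principal UU) ->; have [k [a <-]] := fsurj x.
exists k, (principal_filter a), a; split=> //; first exact: pconv_principal.
by rewrite fmap_principal.
Qed.

Fact finconv_finer F G x :
  ProperFilter G -> F `<=` G -> finconv F x -> finconv G x.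
Proof.
by move=> GG FG [_ Fx]; split=> // U UU GU; apply: Fx => // B /FG; exact: GU.
Qed.

Fact finconvI F G x : finconv F x -> finconv G x -> finconv (F `&` G) x.
Proof.
move=> [FF Fx] [GG Gx]; split; first exact: properfilterI.
by move=> U UU FGU; have [/Fx|/Gx] := ultra_subI UU FGU FF GG; exact.
Qed.

Fact finconv_ultra F x : ProperFilter F ->
  (forall U, UltraFilter U -> F `<=` U -> finconv U x) -> finconv F x.
Proof. by move=> FF FU; split=> // U UU /(FU _ UU)[_]; exact. Qed.

Definition pfinal : psTop :=
  @PsTop T finconv finconv_proper finconv_principal finconv_finer finconvI
    finconv_ultra.

Lemma pfinal_incl k : pcontinuous (@f k : A k -> pfinal).
Proof.
move=> F a Fa; have FF := pconv_proper Fa.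
split=> [|U UU FU]; first exact: fmap_proper_filter.
have [W [WU FW <-]] := ultra_fmap_lift FF UU FU.
by exists k, W, a; split=> //; apply: pconv_finer Fa.
Qed.

Lemma pfinal_map (Z : psTop) (w : pfinal -> Z) :
  (forall k, pcontinuous (w \o @f k)) -> pcontinuous w.
Proof.
move=> cw; apply: pcontinuous_ultra => U x UU [_ /(_ U UU)[]//].
by move=> k [V [a [Va -> ->]]]; exact: cw.
Qed.

Lemma pfinal_lift (U : set_system pfinal) (x : pfinal) :
  UltraFilter U -> pconv U x -> flift U x.
Proof. by move=> UU [_]; exact. Qed.

End Final.

Section Pushout.
Variables (A B C P : psTop) (f : A -> B) (g : A -> C) (h : B -> P) (k : C -> P).
Hypothesis po : is_pushout f g h k.

(** The constant map [True] and the indicator of the joint image both extend the constant cocone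
    [True] on [codisc Prop], so uniqueness makes them equal. *)
Lemma pushout_surj (p : P) : (exists b, h b = p) \/ (exists c, k c = p).
Proof.
have [_ hk univ] := po.
have [w [_ wu]] := univ (codisc Prop) (fun=> True) (fun=> True)
  (@pcontinuous_codisc _ _ _) (@pcontinuous_codisc _ _ _) (fun=> erefl).
have -> : ((exists b, h b = p) \/ (exists c, k c = p)) = w p.
  rewrite (wu (fun p => (exists b, h b = p) \/ (exists c, k c = p))) //; split.
  - exact: pcontinuous_codisc.
  - by move=> b; rewrite propeqE; split=> // _; left; exists b.
  - by move=> c; rewrite propeqE; split=> // _; right; exists c.
by rewrite (wu (fun=> True)) //; split=> //; exact: pcontinuous_codisc.
Qed.

(* The final pseudotopology makes the carrier of [P] a competing pushout, so
   the convergent ultrafilters of [P] are no more than those of that structure. *)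
Lemma pushout_lift (U : set_system P) (p : P) : UltraFilter U -> pconv U p ->
  (exists (V : set_system B) b, [/\ pconv V b, U = h @ V & p = h b]) \/
  (exists (V : set_system C) c, [/\ pconv V c, U = k @ V & p = k c]).
Proof.
move=> UU Up; have [[_ _ ch ck] hk univ] := po.
pose D (b : bool) : psTop := if b then B else C.
pose F (b : bool) : D b -> P := match b with true => h | false => k end.
have Fsurj x : exists b (a : D b), @F b a = x.
  by have [[b <-]|[c <-]] := pushout_surj x; [exists true, b|exists false, c].
have [w [[cw wh wk] _]] := univ (pfinal Fsurj) h k
  (pfinal_incl Fsurj (k := true)) (pfinal_incl Fsurj (k := false)) hk.
(* The identity from the final structure to [P] is continuous, so [w] followed by it is an
   endomorphism of the pushout [P] that fixes the cocone, hence the identity. *)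
have wid : w = id.
  have [v [_ vu]] := univ P h k ch ck hk.
  rewrite -(vu w); first by rewrite -(vu id) //; split=> //; move=> G x.
  split=> // G x Gx; suff cid : pcontinuous (id : pfinal Fsurj -> P).
    exact: (cid _ _ (cw _ _ Gx)).
  by apply: pfinal_map => -[].
have : pconv (w @ U : set_system (pfinal Fsurj)) (w p) by exact: cw.
rewrite wid => /(pfinal_lift UU)[[] [V [a [Va UV pa]]]].
  by left; exists V, a.
by right; exists V, a.
Qed.

Hypothesis ginj : injective g.

(* Tested on the codiscrete space on the set-level pushout [B + (C - g A)]. *)
Lemma pushout_sep :
  [/\ injective h, forall b c, h b = k c -> range g c &
      forall c c', ~ range g c -> k c = k c' -> c = c'].
Proof.
have [_ hk univ] := po.
pose v c : codisc (B + C) :=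
  if pselect (exists a, g a = c) is left e then inl (f (projT1 (cid e)))
  else inr c.
have vg a : inl (f a) = v (g a).
  rewrite /v; case: pselect => [e|[]]; last by exists a.
  by case: (cid e) => a' /= /ginj ->.
have vn c : ~ range g c -> v c = inr c.
  by move=> nc; rewrite /v; case: pselect => // -[a ac]; case: nc; exists a.
have [w [[_ wh wk] _]] := univ (codisc (B + C)) inl v
  (@pcontinuous_codisc _ _ _) (@pcontinuous_codisc _ _ _) vg.
split=> [b b' /(congr1 w)|b c /(congr1 w)|c c' nc /(congr1 w)].
- by rewrite !wh => -[].
- by rewrite wh wk => e; apply: contrapT => /vn; rewrite -e.
- rewrite !wk (vn _ nc) /v; case: pselect => // _ [] //.
Qed.

End Pushout.

Section SeqColimit.
Variables (S : nat -> psTop) (j : forall n, S n -> S n.+1) (X : psTop)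
          (c : forall n, S n -> X).
Hypothesis col : is_seq_colimit j c.

Lemma seq_colimit_surj (x : X) : exists n s, c (n := n) s = x.
Proof.
have [_ cj univ] := col.
have [w [_ wu]] := univ (codisc Prop) (fun _ _ => True)
  (fun=> @pcontinuous_codisc _ _ _) (fun _ _ => erefl).
have -> : (exists n s, c (n := n) s = x) = w x.
  rewrite (wu (fun x => exists n s, c (n := n) s = x)) //; split.
    exact: pcontinuous_codisc.
  by move=> n s; rewrite propeqE; split=> // _; exists n, s.
by rewrite (wu (fun=> True)) //; split=> //; exact: pcontinuous_codisc.
Qed.

Lemma seq_colimit_lift (U : set_system X) (x : X) : UltraFilter U ->
  pconv U x -> flift c U x.
Proof.
move=> UU Ux; have [[cj cc] cE univ] := col.
have [w [[cw wc] _]] := univ (pfinal seq_colimit_surj) c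
  (pfinal_incl seq_colimit_surj) cE.
have wid : w = id.
  have [v [_ vu]] := univ X c cc cE.
  rewrite -(vu w); first by rewrite -(vu id) //; split=> //; move=> G y.
  split=> // G y Gy; suff cid : pcontinuous (id : pfinal seq_colimit_surj -> X).
    exact: (cid _ _ (cw _ _ Gy)).
  exact: pfinal_map.
have : pconv (w @ U : set_system (pfinal seq_colimit_surj)) (w x) by exact: cw.
by rewrite wid => /(pfinal_lift UU).
Qed.

End SeqColimit.

(** * The homeomorphism between a disk and a product of two disks *)

Lemma ptop_continuous (T T' : topologicalType) (f : T -> T') :
  continuous f -> pcontinuous (f : ptop T -> ptop T').
Proof.
move=> cf F x [FF xF]; split; first exact: fmap_proper_filter.
by move=> A /cf xA; exact: xF.
Qed.

(** Lets topological continuity of a map out of a product of spaces yield its continuity out of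
    [pprod]. *)
Lemma pprod_ptop (T T' : topologicalType) F (p : T * T') :
  pconv (F : set_system (pprod (ptop T) (ptop T'))) p ->
  pconv (F : set_system (ptop (T * T')%type)) p.
Proof.
case: p => x y [FF [_ /= Fx] [_ /= Fy]]; split=> // A xyA.
have : (fun z : T * T' => (z.1, z.2)) @ F --> (x, y) by exact: cvg_pair.
move=> /(_ A xyA) /=; rewrite /fmap /nbhs /=.
by apply: filterS => -[].
Qed.

(** A neighborhood of a matrix contains a product of neighborhoods of its finitely many entries, so
    the entrywise conditions can be intersected. *)
Lemma cvg_mx (T : topologicalType) m n (F : set_system 'M[T]_(m, n))
    (M : 'M[T]_(m, n)) : Filter F ->
  (forall i j, (fun N : 'M[T]_(m, n) => N i j) @ F --> M i j) -> F --> M.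
Proof.
move=> FF FM A [P MP PA].
have : \forall N \near F, forall ij : 'I_m * 'I_n,
    P ij.1 ij.2 ((N : 'M[T]_(m, n)) ij.1 ij.2).
  by apply: filter_forall => -[i j]; exact: (FM i j _ (MP i j)).
by apply: filterS => N PN; apply: PA => i j; exact: (PN (i, j)).
Qed.

Lemma continuous_mx (U T : topologicalType) m n (f : U -> 'M[T]_(m, n)) :
  (forall i j, continuous (fun u => f u i j)) -> continuous f.
Proof. by move=> cf u; apply: cvg_mx => i j; exact: cf. Qed.

Section Radial.
Variables (R : realType) (V : normedModType R) (N M : V -> R) (C : R).

(* Rescales the unit ball of the gauge [N] onto that of the gauge [M]; at
   [v = 0] the coefficient is the junk value [0 / 0 = 0], which is harmless. *)
Definition radial (v : V) : V := (N v / M v) *: v.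

Hypotheses (cN : continuous N) (cM : continuous M).
Hypotheses (N_ge0 : forall v, 0 <= N v) (M_ge0 : forall v, 0 <= M v).
Hypotheses (NZ : forall t v, 0 <= t -> N (t *: v) = t * N v).
Hypotheses (MZ : forall t v, 0 <= t -> M (t *: v) = t * M v).
Hypothesis M_eq0 : forall v, M v = 0 -> v = 0.
Hypotheses (C_ge0 : 0 <= C) (NM : forall v, N v <= C * M v).

(** Away from [0] the coefficient is a quotient of continuous functions with nonzero denominator. At
    [0] the bound [NM] keeps the coefficient below [C], so the norm of the image is at most [C]
    times that of [v]. *)
Lemma radial_continuous : continuous radial.
Proof.
move=> x; have [->|x0] := eqVneq x 0.
  rewrite /continuous_at /radial scaler0; apply: norm_cvg0.
  apply: (@squeeze_cvgr _ _ _ _ (cst 0) (fun v => C * `|v|)).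
  - near=> v; rewrite normr_ge0 normrZ ler_wpM2r// ger0_norm ?divr_ge0//.
    have [/eqP Mv|Mv] := boolP (M v == 0); first by rewrite Mv invr0 mulr0.
    by rewrite ler_pdivrMr ?NM// lt0r Mv M_ge0.
  - exact: cvg_cst.
  - rewrite -(mulr0 C) -(@normr0 _ V); apply: cvgM; first exact: cvg_cst.
    exact: norm_continuous.
apply: cvgZ; last exact: cvg_id.
apply: cvgM; first exact: cN.
apply: cvgV; last exact: cM.
by apply: contra_neq x0; exact: M_eq0.
Unshelve. all: by end_near. Qed.

Lemma radialE v : M (radial v) = N v.
Proof.
have [M0|M0] := eqVneq (M v) 0; last by rewrite MZ ?divr_ge0// divfK.
have -> : v = 0 *: v by rewrite scale0r (M_eq0 M0).
by rewrite NZ// mul0r /radial scale0r scaler0 -(scale0r v) MZ// mul0r.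
Qed.

End Radial.

(** By homogeneity the ratio of the two gauges is constant on open rays from the origin, so the two
    coefficients are reciprocal. *)
Lemma radialK (R : realType) (V : normedModType R) (N M : V -> R) :
  (forall v, 0 <= N v) -> (forall v, 0 <= M v) ->
  (forall t v, 0 <= t -> N (t *: v) = t * N v) ->
  (forall t v, 0 <= t -> M (t *: v) = t * M v) ->
  (forall v, N v = 0 -> v = 0) -> (forall v, M v = 0 -> v = 0) ->
  cancel (radial N M) (radial M N).
Proof.
move=> N0 M0 NZ MZ Nd Md v; have [vE|Nv] := eqVneq (N v) 0.
  by rewrite (Nd _ vE) /radial !scaler0.
have Mv : M v != 0.
  apply: contra_neq Nv => /Md ->; rewrite -(scale0r v) NZ //; exact: mul0r.
rewrite /radial scalerA MZ ?NZ ?divr_ge0// -[RHS]scale1r; congr (_ *: _).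
by field; rewrite Nv Mv.
Qed.

(** * Euclidean length, and the gauge of a product of two disks *)

Section Euclid.
Variable R : realType.

Definition len n (v : 'rV[R]_n) : R := Num.sqrt (\sum_i v ord0 i ^+ 2).

Lemma sumsq_ge0 n (v : 'rV[R]_n) : 0 <= \sum_i v ord0 i ^+ 2.
Proof. by apply: sumr_ge0 => i _; exact: sqr_ge0. Qed.

Lemma len_ge0 n (v : 'rV[R]_n) : 0 <= len v.
Proof. exact: sqrtr_ge0. Qed.

Lemma lenZ n t (v : 'rV[R]_n) : 0 <= t -> len (t *: v) = t * len v.
Proof.
move=> t0; rewrite /len; under eq_bigr do rewrite mxE exprMn.
by rewrite -mulr_sumr sqrtrM ?sqr_ge0// sqrtr_sqr ger0_norm.
Qed.

Lemma len_eq0 n (v : 'rV[R]_n) : len v = 0 -> v = 0.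
Proof.
move/eqP; rewrite sqrtr_eq0 => v0; apply/rowP => i; rewrite mxE.
have /eqP : \sum_i v ord0 i ^+ 2 = 0.
  by apply/eqP; rewrite eq_le v0 sumsq_ge0.
rewrite psumr_eq0; last by move=> ? _; exact: sqr_ge0.
by move/allP => /(_ i (mem_index_enum _)); rewrite sqrf_eq0 => /eqP.
Qed.

Lemma len_continuous n : continuous (@len n).
Proof.
move=> v; apply: (@continuous_comp _ _ _ _ Num.sqrt); last exact: sqrt_continuous.
apply: continuous_big => [|i _ {}v]; first exact: add_continuous.
by apply: (@continuousM _ _ _ _ v); exact: coord_continuous.
Qed.

Lemma disk_setE n (v : 'rV[R]_n) : disk_set v = (len v <= 1).
Proof.
by rewrite /disk_set /= -[in LHS](sqr_sqrtr (sumsq_ge0 v)) expr_le1 ?len_ge0.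
Qed.

Lemma sphere_setE n (v : 'rV[R]_n) : sphere_set v = (len v = 1).
Proof.
rewrite /sphere_set /= propeqE; split=> [v1|v1]; first by rewrite /len v1 sqrtr1.
by rewrite -(sqr_sqrtr (sumsq_ge0 v)) -/(len v) v1 expr1n.
Qed.

Lemma sumsq_split p q (v : 'rV[R]_(p + q)) :
  \sum_i v ord0 i ^+ 2 = \sum_i lsubmx v ord0 i ^+ 2 + \sum_i rsubmx v ord0 i ^+ 2.
Proof.
by rewrite big_split_ord; congr (_ + _); apply: eq_bigr => i _; rewrite mxE.
Qed.

(** The gauge whose unit ball is D^p * D^q and whose unit sphere is the boundary of that product. *)
Definition maxlen p q (v : 'rV[R]_(p + q)) : R :=
  Num.max (len (lsubmx v)) (len (rsubmx v)).

Section PQ.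
Variables p q : nat.
Implicit Types v : 'rV[R]_(p + q).

Lemma lsubmx_continuous : continuous (lsubmx : 'rV[R]_(p + q) -> 'rV[R]_p).
Proof.
apply: continuous_mx => i j; under eq_fun do rewrite mxE.
exact: coord_continuous.
Qed.

Lemma rsubmx_continuous : continuous (rsubmx : 'rV[R]_(p + q) -> 'rV[R]_q).
Proof.
apply: continuous_mx => i j; under eq_fun do rewrite mxE.
exact: coord_continuous.
Qed.

Lemma row_mx_continuous :
  continuous (fun v : 'rV[R]_p * 'rV[R]_q => row_mx v.1 v.2).
Proof.
apply: continuous_mx => i j; under eq_fun do rewrite mxE.
case: (fintype.split j) => k v.
- apply: (@continuous_comp _ _ _ fst (fun w : 'rV[R]_p => w i k)).
    exact: cvg_fst.
  exact: coord_continuous.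
- apply: (@continuous_comp _ _ _ snd (fun w : 'rV[R]_q => w i k)).
    exact: cvg_snd.
  exact: coord_continuous.
Qed.

Lemma maxlen_ge0 v : 0 <= maxlen v.
Proof. by rewrite /maxlen le_max len_ge0. Qed.

Lemma maxlenZ t v : 0 <= t -> maxlen (t *: v) = t * maxlen v.
Proof. by move=> t0; rewrite /maxlen !linearZ /= !lenZ // maxr_pMr. Qed.

Lemma maxlen_eq0 v : maxlen v = 0 -> v = 0.
Proof.
move=> v0; have : len (lsubmx v) = 0 /\ len (rsubmx v) = 0.
  by split; apply/eqP; rewrite eq_le len_ge0 -v0 /maxlen le_max lexx ?orbT.
move=> [/len_eq0 l0 /len_eq0 r0]; rewrite -(hsubmxK v) l0 r0; exact: row_mx0.
Qed.

Lemma maxlen_continuous : continuous (@maxlen p q).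
Proof.
move=> v.
apply: (@continuous_max _ _ (@len p \o lsubmx) (@len q \o rsubmx)).
- apply: (@continuous_comp _ _ _ lsubmx (@len p)); first exact: lsubmx_continuous.
  exact: len_continuous.
- apply: (@continuous_comp _ _ _ rsubmx (@len q)); first exact: rsubmx_continuous.
  exact: len_continuous.
Qed.

(** The factor [1] gives the bound the shape [N v <= C * M v] asked by [radial_continuous]. *)
Lemma maxlen_le_len v : maxlen v <= 1 * len v.
Proof.
rewrite mul1r /maxlen ge_max; apply/andP; split; apply: ler_wsqrtr.
  by rewrite sumsq_split lerDl sumsq_ge0.
by rewrite sumsq_split lerDr sumsq_ge0.
Qed.

(** With [m = maxlen v], the sum of the two squared lengths is at most [2 * m ^+ 2], below
    [(2 * m) ^+ 2]; any constant serves for the continuity of the rescaling at the origin. *)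
Lemma len_le_maxlen v : len v <= 2 * maxlen v.
Proof.
have l0 := len_ge0 (lsubmx v); have r0 := len_ge0 (rsubmx v).
have lm : len (lsubmx v) <= maxlen v by rewrite le_max lexx.
have rm : len (rsubmx v) <= maxlen v by rewrite le_max lexx orbT.
have m0 := maxlen_ge0 v.
rewrite -[leRHS]ger0_norm ?mulr_ge0// -sqrtr_sqr; apply: ler_wsqrtr.
rewrite sumsq_split -(sqr_sqrtr (sumsq_ge0 (lsubmx v))).
rewrite -(sqr_sqrtr (sumsq_ge0 (rsubmx v))) -/(len _) -/(len _).
nra.
Qed.

End PQ.
End Euclid.

Lemma set_val_continuous (T : topologicalType) (A : set T) :
  continuous (set_val : A -> T).
Proof. exact: initial_continuous. Qed.

Lemma continuous_set_val (U T : topologicalType) (A : set T) (f : U -> A) :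
  continuous (set_val \o f) -> continuous f.
Proof. exact: continuous_comp_initial. Qed.

(** * Disks, their boundary spheres, and the splitting of D^(p+q) into D^p * D^q *)

Section Disk.
Variable R : realType.

Definition mk_disk n (v : 'rV[R]_n) (vD : disk_set v) : disk R n :=
  exist _ v (mem_set vD).

Lemma disk_len n (x : disk R n) : len (set_val x) <= 1.
Proof. by rewrite -disk_setE; exact: set_valP. Qed.

Definition bdy n : set (disk R n) := [set x | len (set_val x) = 1].

Lemma bdyE n : @bdy n = range (@sphere_incl R n).
Proof.
rewrite eqEsubset; split=> [x|_ [x _ <-]].
  rewrite /bdy /= -sphere_setE => xS.
  by exists (exist _ (set_val x) (mem_set xS)) => //; exact: val_inj.
by rewrite /bdy /= -sphere_setE; exact: (set_valP x).
Qed.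

Lemma sphere_incl_inj n : injective (@sphere_incl R n).
Proof. by move=> x y /(congr1 set_val)/= xy; apply: val_inj. Qed.

Lemma sphere_incl_continuous n : pcontinuous (@sphere_incl R n).
Proof.
apply: ptop_continuous; apply: continuous_set_val.
exact: set_val_continuous.
Qed.

(** The boundary is closed, so it contains the limit. The ultrafilter contains the range of the
    injection [sphere_incl], hence is the image of a filter on the sphere, which converges because
    the sphere has the subspace topology. *)
Lemma sphere_lift n (V : set_system (disk R n)) (x : disk R n) :
  UltraFilter V -> pconv V x -> V (@bdy n) ->
  exists (W : set_system (sphere R n)) y,
    [/\ UltraFilter W, pconv W y, V = @sphere_incl R n @ W & x = sphere_incl y].
Proof.
move=> VU [_ xV] Vb.
have xb : bdy x.
  apply: (@closed_cvg _ _ V _ (fun z : disk R n => len (set_val z))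
    [set r | r = 1]) => //.
  apply: (@cvg_comp _ _ _ _ (@len R n) V (nbhs (set_val x))).
    by move=> A /set_val_continuous; exact: xV.
  exact: len_continuous.
have Vr : V (range (@sphere_incl R n)) by rewrite -bdyE.
have [WP VW] := fmap_image_inj (@sphere_incl_inj n) (ultra_proper (F:=V)) Vr.
have [y _ yx] : range (@sphere_incl R n) x by rewrite -bdyE.
exists [set B | V (@sphere_incl R n @` B)], y; split=> //.
- by apply: (ultra_fmap_inj (@sphere_incl_inj n) WP); rewrite -VW.
- split=> // A [_ [[B Bop <-] By]] BA; rewrite /=.
  have : V (set_val @^-1` B).
    apply: xV; apply: set_val_continuous.
    by apply: open_nbhs_nbhs; split=> //; rewrite -yx.
  move/(filterI Vr); apply: filterS => _ [[z _ <-] Bz].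
  by exists z => //; exact: BA.
Qed.

Section Homeo.
Variables p q : nat.

Definition to_box : 'rV[R]_(p + q) -> 'rV[R]_(p + q) :=
  radial (@len R (p + q)) (@maxlen R p q).
Definition of_box : 'rV[R]_(p + q) -> 'rV[R]_(p + q) :=
  radial (@maxlen R p q) (@len R (p + q)).

Lemma maxlen_to_box v : maxlen (to_box v) = len v.
Proof.
apply: radialE; [exact: len_ge0|exact: maxlen_ge0|exact: lenZ|exact: maxlenZ|].
exact: maxlen_eq0.
Qed.

Lemma len_of_box v : len (of_box v) = maxlen v.
Proof.
apply: radialE; [exact: maxlen_ge0|exact: len_ge0|exact: maxlenZ|exact: lenZ|].
exact: len_eq0.
Qed.

Lemma to_boxK : cancel to_box of_box.
Proof.
apply: radialK; [exact: len_ge0|exact: maxlen_ge0|exact: lenZ|exact: maxlenZ| |].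
  exact: len_eq0.
exact: maxlen_eq0.
Qed.

Lemma of_boxK : cancel of_box to_box.
Proof.
apply: radialK; [exact: maxlen_ge0|exact: len_ge0|exact: maxlenZ|exact: lenZ| |].
  exact: maxlen_eq0.
exact: len_eq0.
Qed.

Lemma to_box_continuous : continuous to_box.
Proof.
apply: (@radial_continuous _ _ _ _ 2).
- exact: len_continuous.
- exact: maxlen_continuous.
- exact: len_ge0.
- exact: maxlen_ge0.
- exact: maxlen_eq0.
- by [].
- exact: len_le_maxlen.
Qed.

Lemma of_box_continuous : continuous of_box.
Proof.
apply: (@radial_continuous _ _ _ _ 1).
- exact: maxlen_continuous.
- exact: len_continuous.
- exact: maxlen_ge0.
- exact: len_ge0.
- exact: len_eq0.
- by [].
- exact: maxlen_le_len.
Qed.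

Lemma dfst_subproof (z : disk R (p + q)) :
  disk_set (lsubmx (to_box (set_val z))).
Proof.
rewrite disk_setE; apply: le_trans (disk_len z).
by rewrite -maxlen_to_box le_max lexx.
Qed.

Lemma dsnd_subproof (z : disk R (p + q)) :
  disk_set (rsubmx (to_box (set_val z))).
Proof.
rewrite disk_setE; apply: le_trans (disk_len z).
by rewrite -maxlen_to_box le_max lexx orbT.
Qed.

Lemma djoin_subproof (z : disk R p * disk R q) :
  disk_set (of_box (row_mx (set_val z.1) (set_val z.2))).
Proof.
by rewrite disk_setE len_of_box ge_max row_mxKl row_mxKr !disk_len.
Qed.

Definition dsplit (z : disk R (p + q)) : pprod (disk R p) (disk R q) :=
  (mk_disk (dfst_subproof z), mk_disk (dsnd_subproof z)).

Definition djoin (z : pprod (disk R p) (disk R q)) : disk R (p + q) :=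
  mk_disk (djoin_subproof z).

Lemma dsplitK : cancel dsplit djoin.
Proof. by move=> z; apply: val_inj; rewrite /= hsubmxK to_boxK. Qed.

Lemma djoinK : cancel djoin dsplit.
Proof.
move=> [x y]; congr pair; apply: val_inj; rewrite /= of_boxK.
- exact: row_mxKl.
- exact: row_mxKr.
Qed.

(** The rescaling carries [len] to [maxlen], and a maximum of two numbers at most 1 equals 1 exactly
    when one of them does. *)
Lemma dsplit_bdy (z : disk R (p + q)) :
  bdy z <-> bdy (dsplit z).1 \/ bdy (dsplit z).2.
Proof.
rewrite /bdy /= -(maxlen_to_box (set_val z)) /maxlen.
have := disk_len (dsplit z).1; have := disk_len (dsplit z).2.
rewrite /dsplit /mk_disk /= /set_val /=.
move: (len _) (len _) => a b a1 b1.
split=> [|[->|->]]; last 2 first.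
- by rewrite max_l.
- by rewrite max_r.
by have [ab|ab] := leP b a => ?; [left|right].
Qed.

Lemma dsplit_continuous : pcontinuous dsplit.
Proof.
move=> F z Fz; have FF := pconv_proper Fz.
split; first exact: fmap_proper_filter.
- suff : pcontinuous (fst \o dsplit) by exact.
  apply: ptop_continuous; apply: continuous_set_val => x.
  apply: (@continuous_comp _ _ _ (to_box \o set_val) lsubmx).
    apply: continuous_comp; first exact: set_val_continuous.
    exact: to_box_continuous.
  exact: lsubmx_continuous.
- suff : pcontinuous (snd \o dsplit) by exact.
  apply: ptop_continuous; apply: continuous_set_val => x.
  apply: (@continuous_comp _ _ _ (to_box \o set_val) rsubmx).
    apply: continuous_comp; first exact: set_val_continuous.
    exact: to_box_continuous.
  exact: rsubmx_continuous.
Qed.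

Lemma djoin_continuous : pcontinuous djoin.
Proof.
move=> F z /pprod_ptop; apply: ptop_continuous.
apply: continuous_set_val => x.
apply: (@continuous_comp _ _ _
  (fun z : set_type (@disk_set R p) * set_type (@disk_set R q) =>
     row_mx (set_val z.1) (set_val z.2)) of_box).
  apply: (@continuous_comp _ _ _
    (fun z : set_type (@disk_set R p) * set_type (@disk_set R q) =>
       (set_val z.1, set_val z.2))
    (fun v : 'rV[R]_p * 'rV[R]_q => row_mx v.1 v.2)).
    have c1 : set_val z.1 @[z --> x] --> set_val x.1.
      by apply: (@cvg_comp _ _ _ fst); [exact: cvg_fst|exact: set_val_continuous].
    have c2 : set_val z.2 @[z --> x] --> set_val x.2.
      by apply: (@cvg_comp _ _ _ snd); [exact: cvg_snd|exact: set_val_continuous].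
    exact: cvg_pair c1 c2.
  exact: row_mx_continuous.
exact: of_box_continuous.
Qed.

End Homeo.
End Disk.

(** * Cell structures *)

(** Lifts through final structures are only convergent filters; this refines them to ultrafilters,
    and the image does not change because it is already maximal. *)
Lemma ultra_pconv_lift (X : psTop) T (f : X -> T) (V : set_system X) x :
  UltraFilter (f @ V) -> pconv V x ->
  exists W, [/\ UltraFilter W, pconv W x & f @ W = f @ V].
Proof.
move=> fVU Vx; have VV := pconv_proper Vx.
have [W [WU VW <-]] := ultra_fmap_lift VV fVU (fun _ => id).
by exists W; split=> //; exact: pconv_finer Vx.
Qed.

Lemma existT_nat_inj (P : nat -> Type) n (x y : P n) :
  existT P n x = existT P n y -> x = y.
Proof.
move=> e; have := projT2_eq e.
by rewrite (Prop_irrelevance (projT1_eq e) erefl).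
Qed.

Lemma psum_incl_continuous (I : Type) (A : I -> psTop) i :
  pcontinuous (existT (fun i => A i) i : A i -> psum A).
Proof. by have [+ _] := psum_universal A; exact. Qed.

Lemma psum_continuous (I : Type) (A : I -> psTop) (Z : psTop) (f : psum A -> Z) :
  (forall i, pcontinuous (fun x : A i => f (existT (fun i => A i) i x))) ->
  pcontinuous f.
Proof. by move=> cf F [i x] [G Gx ->]; exact: cf Gx. Qed.

Lemma cells_incl_inj (R : realType) n (I : Type) : injective (@cells_incl R n I).
Proof.
move=> [i x] [k y]; rewrite /cells_incl /= => e; have := projT1_eq e => /= ik.
subst k; congr existT; apply: sphere_incl_inj.
exact: (existT_inj (X := fun _ : I => disk R n) e).
Qed.

(* An intrinsic description of CW complexes, without skeleta: [cell_lift] says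
   that the convergent ultrafilters of [X] are those coming from closed cells,
   and [cell_bdy] that the attaching maps are continuous into the union of the
   cells of lower dimension, which carries the final structure of these cells. *)
Record cell_structure (R : realType) (X : psTop) (I : nat -> Type)
    (Phi : forall n, I n -> disk R n -> X) : Prop := CellStructure {
  cell_cont : forall n (i : I n), pcontinuous (Phi n i);
  cell_lift : forall (U : set_system X) x, UltraFilter U -> pconv U x ->
    exists n (i : I n) V y,
      [/\ pconv V y, U = Phi n i @ V & x = Phi n i y];
  cell_uniq : forall n (i : I n) y m (k : I m) z, ~ bdy y -> ~ bdy z ->
    Phi n i y = Phi m k z ->
    existT (fun n => I n * disk R n)%type n (i, y) = existT _ m (k, z);
  cell_bdy : forall n (i : I n) (V : set_system (disk R n)) y,
    UltraFilter V -> pconv V y -> V (@bdy R n) ->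
    exists m (k : I m) W z,
      [/\ (m < n)%N, pconv W z, Phi n i @ V = Phi m k @ W &
          Phi n i y = Phi m k z]
}.

(** * From a CW complex to a cell structure *)

Section CellsOfCW.
Variables (R : realType) (X : psTop) (S : nat -> psTop).
Variables (j : forall n, S n -> S n.+1) (c : forall n, S n -> X).
Variables (I : nat -> Type).
Variables (phi : forall n, psum (fun _ : I n => sphere R n) -> S n).
Variables (Phi : forall n, psum (fun _ : I n => disk R n) -> S n.+1).
Hypothesis S0 : S 0%N -> False.
Hypothesis po : forall n,
  is_pushout (@phi n) (cells_incl n (I n)) (@j n) (@Phi n).
Hypothesis col : is_seq_colimit j c.

Definition char_map n (i : I n) (y : disk R n) : X :=
  c (Phi (existT (fun=> disk R n : Type) i y)).

Let T := {n & (I n * disk R n)%type}.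

Let cj n s : c (@j n s) = c s. Proof. by case: col. Qed.

Let Phi_bdy n (i : I n) y : bdy y <->
  range (cells_incl n (I n)) (existT (fun=> disk R n : Type) i y).
Proof.
rewrite bdyE; split=> [[x _ <-]|[[k x] _ e]].
  by exists (existT _ i x).
have := projT1_eq e => /= ki; subst k.
by exists x => //; exact: (existT_inj (X := fun _ : I n => disk R n) e).
Qed.

(** By induction along the pushouts: an ultrafilter on [S n.+1] comes either from [S n] or from the
    sum of the n-disks, where a convergent filter lives on a single disk. The bound is strict since
    [S n] is the (n-1)-skeleton. *)
Lemma stage_lift n (U : set_system (S n)) (s : S n) :
  UltraFilter U -> pconv U s ->
  exists m (k : I m) W z,
    [/\ (m < n)%N, pconv W z, @c n @ U = char_map k @ W & c s = char_map k z].
Proof.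
elim: n U s => [|n ih] U s UU Us; first by case: (S0 s).
have [[V [t [Vt UE ->]]]|[V [p [Vp UE ->]]]] := pushout_lift (po n) UU Us.
- have [|V' [V'U V't V'E]] := ultra_pconv_lift (f := @j n) _ Vt.
    by rewrite -UE.
  have [m [k [W [z [mn Wz WE zE]]]]] := ih _ _ V'U V't.
  exists m, k, W, z; split=> //; [exact: ltnW| |by rewrite cj].
  rewrite -WE UE -V'E; suff <- : @c n.+1 \o @j n = @c n by [].
  by apply/funext => r; exact: (cj r).
- move: p Vp => [i y] [G Gy VE]; exists n, i, G, y; split=> //.
  by rewrite UE VE.
Qed.

Lemma char_map_continuous n (i : I n) : pcontinuous (@char_map n i).
Proof.
have [[_ cc] _ _] := col; have [[_ _ _ cPhi] _ _] := po n.
move=> F y Fy.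
exact: (cc _ _ _ (cPhi _ _ (@psum_incl_continuous _ (fun=> disk R n) i _ _ Fy))).
Qed.

Lemma char_map_lift (U : set_system X) x : UltraFilter U -> pconv U x ->
  exists n (i : I n) V y,
    [/\ pconv V y, U = @char_map n i @ V & x = @char_map n i y].
Proof.
move=> UU /(seq_colimit_lift col UU)[n [V [s [Vs UE ->]]]].
have [|V' [V'U V's V'E]] := ultra_pconv_lift (f := @c n) _ Vs.
  by rewrite -UE.
have [m [k [W [z [_ Wz WE zE]]]]] := stage_lift V'U V's.
by exists m, k, W, z; split=> //; rewrite UE -V'E.
Qed.

(** The ultrafilter comes from the sphere; the attaching map sends it into [S n], where [stage_lift]
    finds a cell of lower dimension. *)
Lemma char_map_bdy n (i : I n) (V : set_system (disk R n)) y :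
  UltraFilter V -> pconv V y -> V (@bdy R n) ->
  exists m (k : I m) W z,
    [/\ (m < n)%N, pconv W z, @char_map n i @ V = @char_map m k @ W &
        @char_map n i y = @char_map m k z].
Proof.
move=> VU Vy Vb; have [W [x [WU Wx -> ->]]] := sphere_lift VU Vy Vb.
have [[cphi _ _ _] hk _] := po n.
pose f (x : sphere R n) : S n := phi (existT (fun=> sphere R n : Type) i x).
have cf : pcontinuous f.
  move=> F t Ft.
  exact: (cphi _ _ (@psum_incl_continuous _ (fun=> sphere R n) i _ _ Ft)).
have fE x' : c (f x') = char_map i (sphere_incl x').
  by rewrite /char_map -cj hk.
have [m [k [W' [z [mn W'z WE zE]]]]] := stage_lift (ultra_fmap f WU) (cf _ _ Wx).
exists m, k, W', z; split=> //; last by rewrite -fE.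
rewrite -WE -[LHS]/((@char_map n i \o @sphere_incl R n) @ W).
suff <- : @c n \o f = @char_map n i \o @sphere_incl R n by [].
by apply/funext => x'; exact: fE.
Qed.

Let j_inj n : injective (@j n).
Proof. by have [] := pushout_sep (po n) (@cells_incl_inj R n (I n)). Qed.

Let j_Phi n (s : S n) i y :
  j s = Phi (existT (fun=> disk R n : Type) i y) -> bdy y.
Proof.
have [_ + _] := pushout_sep (po n) (@cells_incl_inj R n (I n)).
by move=> h /h /Phi_bdy.
Qed.

Let Phi_inj n (i k : I n) y z : ~ bdy y ->
  Phi (existT (fun=> disk R n : Type) i y) = Phi (existT _ k z) ->
  (i, y) = (k, z).
Proof.
have [_ _ +] := pushout_sep (po n) (@cells_incl_inj R n (I n)).
move=> h yb e; have {}e := h _ _ (fun r => yb ((Phi_bdy i y).2 r)) e.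
have := projT1_eq e => /= ik; subst k; congr pair.
exact: (existT_inj (X := fun _ : I n => disk R n) e).
Qed.

(** An informative sum, obtained by choice, so that [locate] can branch on it. *)
Let stage_cases n (s : S n.+1) : {t | @j n t = s} +
  {p : I n * disk R n |
    ~ bdy p.2 /\ Phi (existT (fun=> disk R n : Type) p.1 p.2) = s}.
Proof.
have [e|ne] := pselect (exists t, @j n t = s); first by left; exact: cid.
right; apply: cid; have [[t ts]|[[i y] yE]] := pushout_surj (po n) s.
  by exfalso; apply: ne; exists t.
exists (i, y); split=> // /(Phi_bdy i)[a _ aE]; apply: ne.
by exists (phi a); have [_ -> _] := po n; rewrite aE.
Qed.

(* As a map to a codiscrete space, this extends to the colimit, where it shows
   that open cells stay disjoint. *)
Fixpoint locate n : S n -> T :=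
  match n return S n -> T with
  | 0 => fun s => False_rect T (S0 s)
  | n'.+1 => fun s => match stage_cases s with
                      | inl t => locate (sval t)
                      | inr p => existT _ n' (sval p)
                      end
  end.

Lemma locate_j n (s : S n) : locate (j s) = locate s.
Proof.
rewrite /=; case: stage_cases => [[t /= /j_inj -> //]|[[i y] [/= yb]]].
by move=> /esym /j_Phi.
Qed.

Lemma locate_Phi n (i : I n) y : ~ bdy y ->
  locate (Phi (existT (fun=> disk R n : Type) i y)) = existT _ n (i, y).
Proof.
move=> yb /=; case: stage_cases => [[t /= /j_Phi//]|[[k z] [/= zb]]].
by move=> /(Phi_inj zb) ->.
Qed.

Lemma char_map_uniq n (i : I n) y m (k : I m) z : ~ bdy y -> ~ bdy z ->
  char_map i y = char_map k z ->
  existT (fun n => I n * disk R n)%type n (i, y) = existT _ m (k, z).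
Proof.
move=> yb zb; have [_ _ univ] := col.
have [w [[_ wE] _]] := univ (codisc T) locate
  (fun=> @pcontinuous_codisc _ _ _) locate_j.
by move=> /(congr1 w); rewrite !wE !locate_Phi.
Qed.

Lemma char_map_cell_structure : cell_structure char_map.
Proof.
split; [exact: char_map_continuous|exact: char_map_lift|exact: char_map_uniq|].
exact: char_map_bdy.
Qed.

End CellsOfCW.

Lemma CW_cell_structure (R : realType) (X : psTop) : is_CW R X ->
  exists I (Phi : forall n, I n -> disk R n -> X), cell_structure Phi.
Proof.
move=> [S [j [c [S0 H col]]]].
pose I n := projT1 (cid (H n)); pose H1 n := cid (projT2 (cid (H n))).
pose phi n := projT1 (H1 n); pose H2 n := cid (projT2 (H1 n)).
pose Phi n := projT1 (H2 n).
have po n : is_pushout (phi n) (cells_incl n (I n)) (j n) (Phi n).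
  exact: (projT2 (H2 n)).
by exists I, (char_map c Phi); exact: (char_map_cell_structure S0 po col).
Qed.

(** * From a cell structure to a CW complex: skeleta, pushouts and colimit *)

Section CWOfCells.
Variables (R : realType) (X : psTop) (I : nat -> Type).
Variable Phi : forall n, I n -> disk R n -> X.
Hypothesis cs : cell_structure Phi.

(** The pointwise form of [cell_bdy], read off the principal ultrafilter at [y]. *)
Lemma cell_bdy_lower n (i : I n) y : bdy y ->
  exists m (k : I m) z, (m < n)%N /\ Phi i y = Phi k z.
Proof.
move=> yb; have [|m [k [W [z [mn _ _ zE]]]]] :=
  cell_bdy cs i (principal_filter_ultra y) (pconv_principal y).
  exact/principal_filterP.
by exists m, k, z.
Qed.

Lemma cell_interior n (i : I n) y :
  exists m (k : I m) z, [/\ (m <= n)%N, ~ bdy z & Phi i y = Phi k z].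
Proof.
elim/ltn_ind: n i y => n ih i y.
have [yb|yb] := pselect (bdy y); last by exists n, i, y.
have [m [k [z [mn ->]]]] := cell_bdy_lower i yb.
have [m' [k' [z' [mm' zb ->]]]] := ih m mn k z.
by exists m', k', z'; split=> //; exact: leq_trans mm' (ltnW mn).
Qed.

(** Otherwise the point would lie in an open n-cell and also, by [cell_interior], in an open cell of
    dimension at most [m], against [cell_uniq]. *)
Lemma cell_bdyP n (i : I n) y m (k : I m) z :
  (m < n)%N -> Phi i y = Phi k z -> bdy y.
Proof.
move=> mn e; apply: contrapT => yb.
have [m' [k' [z' [mm' zb ze]]]] := cell_interior k z.
have /(congr1 (@projT1 _ _))/= nm' := cell_uniq cs yb zb (etrans e ze).
by move: (leq_ltn_trans mm' mn); rewrite nm' ltnn.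
Qed.

(** The strict bound makes [stage 0] empty and [stage n] the (n-1)-skeleton, matching the indexing
    of [is_CW]. *)
Definition stage n : Type :=
  {x : X | exists m (i : I m) y, (m < n)%N /\ Phi i y = x}.

Lemma stage_inj n : injective (sval : stage n -> X).
Proof.
by move=> [x px] [y py] /= e; subst y; congr exist; exact: Prop_irrelevance.
Qed.

Definition cells_lt n : Type := {i : {m & I m} | (projT1 i < n)%N}.

Definition to_stage n (k : cells_lt n) (y : disk R (projT1 (sval k))) : stage n :=
  exist _ (Phi (projT2 (sval k)) y)
    (ex_intro _ _ (ex_intro _ _ (ex_intro _ y (conj (svalP k) erefl)))).

Lemma to_stage_surj n (s : stage n) : exists k y, to_stage (n := n) (k := k) y = s.
Proof.
case: s => x [m [i [y [mn e]]]].
exists (exist _ (existT _ m i) mn), y; exact: stage_inj.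
Qed.

(** It carries the final structure of its closed cells rather than the one induced from [X], so that
    continuity of maps out of it is checked cell by cell. *)
Definition skeleton n : psTop := pfinal (@to_stage_surj n).

Definition cell_in n m (i : I m) (mn : (m < n)%N) (y : disk R m) : skeleton n :=
  to_stage (n := n) (k := exist _ (existT _ m i) mn) y.

Lemma cell_in_continuous n m (i : I m) (mn : (m < n)%N) :
  pcontinuous (cell_in i mn).
Proof.
exact: (pfinal_incl (@to_stage_surj n) (k := exist _ (existT _ m i) mn)).
Qed.

Lemma skeleton_map n (Z : psTop) (w : skeleton n -> Z) :
  (forall m (i : I m) (mn : (m < n)%N), pcontinuous (w \o cell_in i mn)) ->
  pcontinuous w.
Proof. by move=> cw; apply: pfinal_map => -[[m i] mn]; exact: cw. Qed.

Lemma skeleton_cell n (s : skeleton n) :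
  exists m (i : I m) (mn : (m < n)%N) y, s = cell_in i mn y.
Proof. by have [[[m i] mn] [y <-]] := to_stage_surj s; exists m, i, mn, y. Qed.

Fact skel_next_subproof n (s : skeleton n) :
  exists m (i : I m) y, (m < n.+1)%N /\ Phi i y = sval s.
Proof.
case: s => x [m [i [y [mn e]]]]; exists m, i, y; split=> //; exact: ltnW.
Qed.

Definition skel_next n (s : skeleton n) : skeleton n.+1 :=
  exist _ (sval s) (skel_next_subproof s).

Lemma skel_next_inj n : injective (@skel_next n).
Proof. by move=> s t /(congr1 sval)/= /stage_inj. Qed.

Lemma skel_next_cell n m (i : I m) (mn : (m < n)%N) (mn1 : (m < n.+1)%N) y :
  skel_next (cell_in i mn y) = cell_in i mn1 y.
Proof. exact: stage_inj. Qed.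

Lemma skel_next_continuous n : pcontinuous (@skel_next n).
Proof.
apply: skeleton_map => m i mn.
suff -> : @skel_next n \o cell_in i mn = cell_in i (leqW mn).
  exact: cell_in_continuous.
by apply/funext => y; exact: skel_next_cell.
Qed.

Lemma skel_val_continuous n : pcontinuous (sval : skeleton n -> X).
Proof. by apply: skeleton_map => m i mn; exact: (cell_cont cs). Qed.

Fact attach_subproof n (p : psum (fun _ : I n => sphere R n)) :
  exists m (i : I m) y,
    (m < n)%N /\ Phi i y = Phi (projT1 p) (sphere_incl (projT2 p)).
Proof.
have [|m [k [z [mn e]]]] := @cell_bdy_lower n (projT1 p) (sphere_incl (projT2 p)).
  by rewrite bdyE; exists (projT2 p).
by exists m, k, z.
Qed.

Definition attach n (p : psum (fun _ : I n => sphere R n)) : skeleton n :=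
  exist _ _ (attach_subproof p).

Definition characteristic n (p : psum (fun _ : I n => disk R n)) :
    skeleton n.+1 :=
  cell_in (projT1 p) (ltnSn n) (projT2 p).

(** For an ultrafilter on the sphere, [cell_bdy] rewrites its image in [X] as the image of a
    convergent filter on a lower cell; injectivity of the skeleton into [X] moves this equality to
    the skeleton, where that cell is continuous. *)
Lemma attach_continuous n : pcontinuous (@attach n).
Proof.
apply: psum_continuous => i; apply: pcontinuous_ultra => U x UU Ux.
pose g (x : sphere R n) := attach (existT (fun=> sphere R n : Type) i x).
have Ub : (@sphere_incl R n @ U) (@bdy R n).
  by rewrite bdyE; apply: (@filterS _ U _ setT) => [y _|]; [exists y|exact: filterT].
have [m [k [W [z [mn Wz WE zE]]]]] := cell_bdy cs i
  (ultra_fmap (@sphere_incl R n) UU) (sphere_incl_continuous Ux) Ub.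
have gU : g @ U = cell_in k mn @ W by apply: (fmap_inj (@stage_inj n)).
have gx : g x = cell_in k mn z by exact: stage_inj.
by rewrite -[pconv _ _]/(pconv (g @ U) (g x)) gU gx; exact: cell_in_continuous.
Qed.

Lemma characteristic_continuous n : pcontinuous (@characteristic n).
Proof. by apply: psum_continuous => i; exact: cell_in_continuous. Qed.

Lemma cells_incl_continuous n : pcontinuous (cells_incl (R := R) n (I n)).
Proof.
apply: psum_continuous => i F x Fx.
exact: (@psum_incl_continuous _ (fun=> disk R n) i _ _ (sphere_incl_continuous Fx)).
Qed.

Lemma skeleton_cases n (s : skeleton n.+1) :
  (exists t, skel_next t = s) \/ (exists p, characteristic p = s).
Proof.
have [m [i [mn [y ->]]]] := skeleton_cell s.
have := mn; rewrite ltnS leq_eqVlt => /orP[/eqP mE|mn'].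
  by subst m; right; exists (existT _ i y); exact: stage_inj.
by left; exists (cell_in i mn' y); exact: skel_next_cell.
Qed.

(** A point of the new skeleton is old or interior to exactly one n-cell. Where old points and
    n-cells overlap, [cell_bdyP] gives a boundary point, on which [u] and [v] agree. Continuity is
    checked on closed cells, through [v] in dimension [n] and through [u] below. *)
Lemma skeleton_pushout n :
  is_pushout (@attach n) (cells_incl n (I n)) (@skel_next n) (@characteristic n).
Proof.
split.
- split; [exact: attach_continuous|exact: cells_incl_continuous| |].
    exact: skel_next_continuous.
  exact: characteristic_continuous.
- by move=> a; exact: stage_inj.
move=> Z u v cu cv uv.
have bdy_next p : bdy (projT2 p) ->
    exists a, cells_incl n (I n) a = p /\ skel_next (attach a) = characteristic p.
  case: p => i y /=; rewrite bdyE => -[x _ <-]; exists (existT _ i x).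
  by split=> //; exact: stage_inj.
have H s : exists z, (forall t, skel_next t = s -> u t = z) /\
                     (forall p, characteristic p = s -> v p = z).
  have [[t ts]|nt] := pselect (exists t, skel_next t = s).
    exists (u t); split=> [t'|p ps]; first by rewrite -ts => /skel_next_inj ->.
    have [m [i [mn [y tE]]]] := skeleton_cell t.
    have /bdy_next[a [ap aE]] : bdy (projT2 p).
      apply: (@cell_bdyP n (projT1 p) _ m i y mn).
      by move: ps; rewrite -ts tE => /(congr1 sval).
    by rewrite -ap -uv; congr u; apply: skel_next_inj; rewrite aE ps ts.
  (* Here [s] is not an old point, so all its preimages under [characteristic] are interior and
     [cell_uniq] identifies them. *)
  have [//|[p ps]] := skeleton_cases s.
  have nb q : characteristic q = s -> ~ bdy (projT2 q).
    by move=> qs /bdy_next[a [_ aE]]; apply: nt; exists (attach a); rewrite aE.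
  exists (v p); split=> [t ts|q qs]; first by case: nt; exists t.
  have e := cell_uniq cs (nb _ qs) (nb _ ps) (congr1 sval (etrans qs (esym ps))).
  have [] := @existT_nat_inj (fun n => I n * disk R n)%type n _ _ e.
  by case: p {ps e} => ? ?; case: q {qs} => ? ? /= -> ->.
pose w s := sval (cid (H s)).
have wu t : w (skel_next t) = u t.
  by rewrite /w; case: cid => z [/= + _] => /(_ t erefl).
have wv p : w (characteristic p) = v p.
  by rewrite /w; case: cid => z [/= _] => /(_ p erefl).
exists w; split; last first.
  move=> w' [_ w'u w'v]; apply/funext => s.
  by have [[t <-]|[p <-]] := skeleton_cases s; rewrite ?wu ?w'u ?wv ?w'v.
split=> //; apply: skeleton_map => m i mn.
have := mn; rewrite ltnS leq_eqVlt => /orP[/eqP mE|mn'].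
  subst m; have -> : w \o cell_in i mn = fun y => v (existT _ i y).
    by apply/funext => y; rewrite -wv; congr w; exact: stage_inj.
  move=> F y Fy.
  exact: (cv _ _ (@psum_incl_continuous _ (fun=> disk R n) i _ _ Fy)).
have -> : w \o cell_in i mn = u \o cell_in i mn'.
  by apply/funext => y; rewrite /= -wu (skel_next_cell _ _ mn).
by apply: pcontinuous_comp cu; exact: cell_in_continuous.
Qed.

Lemma skeleton_colimit :
  is_seq_colimit skel_next (fun n => (sval : skeleton n -> X)).
Proof.
split=> //.
  by split=> n; [exact: skel_next_continuous|exact: skel_val_continuous].
move=> Z u cu uj.
(* The cocone depends only on the point of [X]: a point of [skeleton m.+1] that occurs in an earlier
   skeleton comes from [skeleton m], where the induction hypothesis applies. *)
have u_le n m (s : skeleton n) (t : skeleton m) :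
    (n <= m)%N -> sval s = sval t -> u m t = u n s.
  elim: m t => [|m ih] t.
    by rewrite leqn0 => /eqP n0; subst n => /stage_inj ->.
  rewrite leq_eqVlt => /orP[/eqP nm|nm]; first by subst n => /stage_inj ->.
  case: t => x px /= sx.
  have px' : exists m0 (i : I m0) y, (m0 < m)%N /\ Phi i y = x.
    have [m0 [i [y [mn e]]]] := svalP s.
    by exists m0, i, y; split; [exact: leq_trans mn nm|exact: etrans e sx].
  rewrite -(ih (exist _ x px')) // -(uj m); congr u; exact: stage_inj.
have uE n m (s : skeleton n) (t : skeleton m) : sval s = sval t -> u n s = u m t.
  by have [nm|/ltnW mn] := leqP n m => e; [rewrite (u_le _ _ s t)|rewrite (u_le _ _ t s)].
have cov x : exists n (s : skeleton n), sval s = x.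
  have [n [i [_ [y [_ _ ->]]]]] :=
    cell_lift cs (principal_filter_ultra x) (pconv_principal x).
  by exists n.+1, (cell_in i (ltnSn n) y).
have H x : exists z, forall n (s : skeleton n), sval s = x -> u n s = z.
  have [n [s sx]] := cov x; exists (u n s) => m t tx.
  by apply: uE; rewrite sx tx.
pose w x := sval (cid (H x)).
have wu n (s : skeleton n) : w (sval s) = u n s.
  by rewrite /w; case: cid => z /= /(_ n s erefl).
exists w; split; last first.
  by move=> w' [_ w'u]; apply/funext => x; have [n [s <-]] := cov x; rewrite wu w'u.
split=> //; apply: pcontinuous_ultra => U x UU Ux.
(* A convergent ultrafilter of [X] lives on one closed n-cell, which lies in [skeleton n.+1], where
   [w] is the continuous map [u n.+1]. *)
have [n [i [V [y [Vy -> ->]]]]] := cell_lift cs UU Ux.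
suff : pcontinuous (w \o Phi i) by exact.
have -> : w \o Phi i = u n.+1 \o cell_in i (ltnSn n).
  by apply/funext => y'; rewrite /= -wu.
by apply: pcontinuous_comp (cu _); exact: cell_in_continuous.
Qed.

Lemma cell_structure_CW : is_CW R X.
Proof.
exists skeleton, skel_next, (fun n => sval); split; last exact: skeleton_colimit.
  by case=> x [m [i [y []]]].
move=> n; exists (I n), (@attach n), (@characteristic n).
exact: skeleton_pushout.
Qed.

End CWOfCells.

(** * The product of two cell structures *)

Section ProductCells.
Variables (R : realType) (X Y : psTop) (I J : nat -> Type).
Variable Phi : forall n, I n -> disk R n -> X.
Variable Psi : forall n, J n -> disk R n -> Y.
Hypotheses (csX : cell_structure Phi) (csY : cell_structure Psi).

(** As an indexed family it gives a product cell the dimension [p + q] by construction, without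
    transport along equalities of dimensions. *)
Inductive prod_cells : nat -> Type :=
  ProdCell p q (i : I p) (k : J q) : prod_cells (p + q).

Definition prod_char n (a : prod_cells n) : disk R n -> pprod X Y :=
  match a in prod_cells n return disk R n -> pprod X Y with
  | ProdCell p q i k => fun z => (Phi i (dsplit z).1, Psi k (dsplit z).2)
  end.

Lemma prod_char_continuous n (a : prod_cells n) : pcontinuous (prod_char a).
Proof.
case: a => p q i k F z Fz; have FF := pconv_proper Fz.
have [_ F1 F2] := dsplit_continuous Fz; split.
- exact: fmap_proper_filter.
- exact: (cell_cont csX i F1).
- exact: (cell_cont csY k F2).
Qed.

Lemma prod_char_djoin p q (i : I p) (k : J q) z :
  prod_char (ProdCell i k) (djoin z) = (Phi i z.1, Psi k z.2).
Proof.
rewrite -[LHS]/(Phi i (dsplit (djoin z)).1, Psi k (dsplit (djoin z)).2).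
by rewrite djoinK.
Qed.

(** Amalgamating [V] and [W] over [U] gives an ultrafilter on D^p * D^q whose projections refine [V]
    and [W]; it therefore converges to [(a, b)], and [djoin] carries it to D^(p+q). *)
Lemma prod_char_lift p q (i : I p) (k : J q) (U : set_system (X * Y))
    (V : set_system (disk R p)) a (W : set_system (disk R q)) b :
  UltraFilter U -> pconv V a -> pconv W b ->
  Phi i @ V = fst @ U -> Psi k @ W = snd @ U ->
  exists T, pconv T (djoin (a, b)) /\ U = prod_char (ProdCell i k) @ T.
Proof.
move=> UU Va Wb VE WE.
have [T [TU VT WT TE]] := ultra_amalgam UU (pconv_proper Va) (pconv_proper Wb) VE WE.
exists (@djoin R p q @ T); split.
  apply: djoin_continuous; split=> /=.
  - exact: ultra_proper.
  - by apply: (pconv_finer _ VT Va); apply: fmap_proper_filter; exact: ultra_proper.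
  - by apply: (pconv_finer _ WT Wb); apply: fmap_proper_filter; exact: ultra_proper.
rewrite -TE -[RHS]/((prod_char (ProdCell i k) \o @djoin R p q) @ T).
suff -> : prod_char (ProdCell i k) \o @djoin R p q =
    (fun z => (Phi i z.1, Psi k z.2)) by [].
by apply/funext => z; exact: prod_char_djoin.
Qed.

Lemma prod_cells_structure : cell_structure prod_char.
Proof.
split.
- exact: prod_char_continuous.
- move=> U [x y] UU [_ /= Ux Uy].
  have [p [i [V [a [Va VE ->]]]]] := cell_lift csX (ultra_fmap fst UU) Ux.
  have [q [k [W [b [Wb WE ->]]]]] := cell_lift csY (ultra_fmap snd UU) Uy.
  have [T [Tab TE]] := prod_char_lift UU Va Wb (esym VE) (esym WE).
  by exists (p + q)%N, (ProdCell i k), T, (djoin (a, b)); rewrite prod_char_djoin.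
- move=> n a y m b z; case: a y => p q i k y; case: b z => p' q' i' k' z.
  rewrite !dsplit_bdy => /not_orP[y1 y2] /not_orP[z1 z2] [e1 e2].
  (* Rebuilding the product cell and its point as a function of the two factors reduces uniqueness
     to congruence, with no elimination of equalities between dimensions. *)
  pose pack (s : {n & I n * disk R n}%type) (t : {n & J n * disk R n}%type) :=
    existT (fun n => prod_cells n * disk R n)%type (projT1 s + projT1 t)%N
      (ProdCell (projT2 s).1 (projT2 t).1,
       djoin ((projT2 s).2, (projT2 t).2)).
  have packE r s (i0 : I r) (k0 : J s) x :
      pack (existT _ r (i0, (dsplit x).1)) (existT _ s (k0, (dsplit x).2)) =
      existT _ (r + s)%N (ProdCell i0 k0, x).
    by rewrite -[x in RHS]dsplitK.
  rewrite -!packE; congr pack; first exact: (cell_uniq csX y1 z1 e1).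
  exact: (cell_uniq csY y2 z2 e2).
- move=> n a V y; case: a V y => p q i k V y VU Vy Vb.
  pose U := prod_char (ProdCell i k) @ V.
  have UU : UltraFilter U by exact: ultra_fmap.
  have [_ V1y V2y] := dsplit_continuous Vy.
  (* The boundary of the product cell is a union of two pieces, and the ultrafilter contains one of
     them. In that factor the cell is replaced by a lower one while the other factor is kept, so the
     total dimension drops. *)
  have [V1b|V1b] := in_ultra_setVsetC ((fst \o @dsplit R p q) @^-1` @bdy R p) VU.
    have [m [i' [W [z [mp Wz WE zE]]]]] :=
      cell_bdy csX i (ultra_fmap (fst \o @dsplit R p q) VU) V1y V1b.
    have [T [Tz TE]] := prod_char_lift UU Wz V2y (esym WE) erefl.
    exists (m + q)%N, (ProdCell i' k), T, (djoin (z, (dsplit y).2)).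
    by rewrite ltn_add2r mp; split=> //; rewrite prod_char_djoin /= zE.
  have V2b : V ((snd \o @dsplit R p q) @^-1` @bdy R q).
    by apply: filterS (filterI Vb V1b) => z [/dsplit_bdy[]].
  have [m [k' [W [z [mq Wz WE zE]]]]] :=
    cell_bdy csY k (ultra_fmap (snd \o @dsplit R p q) VU) V2y V2b.
  have [T [Tz TE]] := prod_char_lift UU V1y Wz erefl (esym WE).
  exists (p + m)%N, (ProdCell i k'), T, (djoin ((dsplit y).1, z)).
  by rewrite ltn_add2l mq; split=> //; rewrite prod_char_djoin /= zE.
Qed.

End ProductCells.

Theorem theoremB1 (R : realType) (X Y : psTop)
  (hX : is_CW R X) (hY : is_CW R Y) :
  is_CW R (pprod X Y).
Proof.
have [I [Phi csX]] := CW_cell_structure hX.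
have [J [Psi csY]] := CW_cell_structure hY.
exact: (cell_structure_CW (prod_cells_structure csX csY)).
Qed.
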